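(* Let $A(t), B(t), C(t)$ be continuous complex $n\times n$ matrix-valued functions on $[t_0;+\infty)$ with $B(t)=B^*(t)$, $C(t)=C^*(t)$ for $t\ge t_0$, and let $\mu(t)$ be a real-valued continuous function on $[t_0;+\infty)$. Suppose that: 1') $B(t)\ge 0$ for $t\ge t_0$; 4') the matrix equation $$B(t)X+XB(t)=2\mu(t)I-A(t)-A^*(t)$$ has a continuously differentiable hermitian solution $X=S(t)$ on $[t_0;+\infty)$; 5') with $D_S(t)= S'(t)+S(t)B(t)S(t)+A^*(t)S(t)+S(t)A(t)-C(t)$, the scalar system $$\phi'=\mu(t)\phi+\frac{\lambda(B(t))}{n}\psi,\qquad \psi'=-\operatorname{tr}(D_S(t))\phi-\mu(t)\psi,\qquad t\ge t_0,$$ is oscillatory. Then the hamiltonian system $$\Phi'=A(t)\Phi+B(t)\Psi,\qquad \Psi'=C(t)\Phi-A^*(t)\Psi,\qquad t\ge t_0,$$ is also oscillatory.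
   Context: $M^*$ denotes the conjugate transpose of $M$, $I$ the $n\times n$ identity matrix. In the hamiltonian system $\Phi,\Psi$ are unknown continuously differentiable complex $n\times n$ matrix-functions on $[t_0;+\infty)$. A solution $(\Phi,\Psi)$ is called prepared if $\Phi^*(t)\Psi(t)=\Psi^*(t)\Phi(t)$ for $t\ge t_0$. A prepared solution is oscillatory if $\det\Phi(t)$ has arbitrarily large zeroes. The hamiltonian system is oscillatory if every prepared solution is oscillatory. A real scalar linear system in unknowns $(\phi,\psi)$ on $[t_0;+\infty)$ is oscillatory if for every (real) solution $(\phi,\psi)$ the function $\phi$ has arbitrarily large zeroes. For a hermitian matrix $H$, $\lambda(H)$ is its least eigenvalue, and $H\ge0$ means $H$ is non-negative definite. *)

(* Defs.v *)
From HB Require Import structures.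
From mathcomp Require Import all_boot all_order all_algebra.
From mathcomp Require Import all_classical all_reals all_analysis.
From mathcomp Require Import complex.

Set Implicit Arguments.
Unset Strict Implicit.
Unset Printing Implicit Defensive.

Import Order.TTheory GRing.Theory Num.Theory.
Import numFieldNormedType.Exports.

Local Open Scope classical_set_scope.
Local Open Scope ring_scope.
Local Open Scope sesquilinear_scope.
Local Open Scope complex_scope.

(* The usual topology of the complex numbers, given by the modulus; the
   matrix spaces 'M[R[i]]_n inherit their topology from it. *)
#[non_forgetful_inheritance]
HB.instance Definition _ (R : realType) := PseudoPointedMetric.copy R[i] R[i]^o.

Section Calculus.
Variables (R : realType) (t0 : R).

(* Punctured neighbourhoods of t relative to [t0, +oo[; they are one-sided at
   the endpoint t0 and the ordinary punctured neighbourhoods when t > t0. *)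
Definition punctured_nbhs (t : R) : set_system R :=
  within [set` `[t0, +oo[] t^'.

Definition quotient (f : R -> R) (t x : R) : R := (x - t)^-1 * (f x - f t).

Definition has_deriv (f : R -> R) : Prop :=
  forall t, t0 <= t -> cvg (quotient f t x @[x --> punctured_nbhs t]).

Definition deriv_at (f : R -> R) (t : R) : R :=
  lim (quotient f t x @[x --> punctured_nbhs t]).

Definition mx_quotient (n : nat) (F : R -> 'M[R[i]]_n) (t x : R) : 'M[R[i]]_n :=
  ((x - t)^-1)%:C *: (F x - F t).

Definition has_mx_deriv (n : nat) (F : R -> 'M[R[i]]_n) : Prop :=
  forall t, t0 <= t -> cvg (mx_quotient F t x @[x --> punctured_nbhs t]).

Definition mx_deriv (n : nat) (F : R -> 'M[R[i]]_n) (t : R) : 'M[R[i]]_n :=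
  lim (mx_quotient F t x @[x --> punctured_nbhs t]).

Definition continuously_differentiable (n : nat) (F : R -> 'M[R[i]]_n) : Prop :=
  has_mx_deriv F /\ {within `[t0, +oo[, continuous (mx_deriv F)}.

Definition arbitrarily_large_zeroes (K : zmodType) (f : R -> K) : Prop :=
  forall T : R, exists t : R, [/\ t0 <= t, T <= t & f t = 0].

End Calculus.

Section Hermitian.
Variables (R : realType) (n : nat).
Implicit Type H : 'M[R[i]]_n.

(* In R[i], 0 <= z means that z is real and non-negative. *)
Definition nonneg_definite H : Prop :=
  H ^t* = H /\ forall v : 'cV[R[i]]_n, 0 <= (v ^t* *m H *m v) ord0 ord0.

(* For a hermitian H with 0 < n all eigenvalues are real and this is the least
   of them; when there is no such number the value is the dummy 0. *)
Definition least_eigenvalue H : R :=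
  xget 0 [set l : R | eigenvalue H l%:C /\
                      forall k : R, eigenvalue H k%:C -> l <= k].

End Hermitian.

Section Systems.
Variables (R : realType) (t0 : R).

(* phi' = a phi + b psi, psi' = c phi + d psi *)
Definition scalar_solution (a b c d phi psi : R -> R) : Prop :=
  [/\ has_deriv t0 phi, has_deriv t0 psi &
      forall t, t0 <= t ->
        deriv_at t0 phi t = a t * phi t + b t * psi t /\
        deriv_at t0 psi t = c t * phi t + d t * psi t].

Definition scalar_oscillatory (a b c d : R -> R) : Prop :=
  forall phi psi : R -> R,
    scalar_solution a b c d phi psi -> arbitrarily_large_zeroes t0 phi.

Variable n : nat.
Implicit Types A B C Phi Psi : R -> 'M[R[i]]_n.

Definition hamiltonian_solution A B C Phi Psi : Prop :=
  [/\ continuously_differentiable t0 Phi, continuously_differentiable t0 Psi &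
      forall t, t0 <= t ->
        mx_deriv t0 Phi t = A t *m Phi t + B t *m Psi t /\
        mx_deriv t0 Psi t = C t *m Phi t - (A t) ^t* *m Psi t].

Definition prepared Phi Psi : Prop :=
  forall t, t0 <= t -> (Phi t) ^t* *m Psi t = (Psi t) ^t* *m Phi t.

Definition hamiltonian_oscillatory A B C : Prop :=
  forall Phi Psi, hamiltonian_solution A B C Phi Psi -> prepared Phi Psi ->
    arbitrarily_large_zeroes t0 (fun t => \det (Phi t)).

Definition D_S A B C (S : R -> 'M[R[i]]_n) (t : R) : 'M[R[i]]_n :=
  mx_deriv t0 S t + S t *m B t *m S t + (A t) ^t* *m S t + S t *m A t - C t.

End Systems.

(* Main.v *)
(* If [\det Phi] vanishes nowhere on [T, +oo[, then [Y = Psi *m invmx Phi] is a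
   hermitian solution of a matrix Riccati equation there.  Equation 4') makes
   the terms linear in [Z = Y - S] contribute [2 mu \tr Z] to the trace, and
   [\tr (Z B Z) >= lambda(B) \tr (Z^2) >= lambda(B) / n * (\tr Z)^2], so
   [y = \tr Z] satisfies the scalar Riccati inequality
     [y' + p y^2 + 2 mu y + q <= 0] with [p = lambda(B) / n], [q = \tr D_S].
   Let [(phi, psi)] solve the linear scalar system with [phi T = 1] and
   [psi T = y T], and put [w = psi - y phi].  Then
   [(phi w)' = p w^2 - (y' + p y^2 + 2 mu y + q) phi^2 >= 0], so [phi w >= 0],
   whence [(phi^2)' >= 2 (mu + p y) phi^2] and [phi] never vanishes after [T]. *)
Require Import Defs.
From mathcomp Require Import all_boot all_order all_algebra.
From mathcomp Require Import all_classical all_reals all_analysis.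
From mathcomp Require Import complex lra ring.
Import Order.TTheory GRing.Theory Num.Theory.
Import numFieldNormedType.Exports.
Local Open Scope classical_set_scope.
Local Open Scope ring_scope.
Local Open Scope sesquilinear_scope.
Local Open Scope complex_scope.

Set Implicit Arguments.
Unset Strict Implicit.
Unset Printing Implicit Defensive.

(** * Calculus on a half-line *)

Lemma within_halfline_continuousP (R : realType) (K : topologicalType) (a : R)
    (f : R -> K) :
  {within `[a, +oo[, continuous f} <->
  forall t, a <= t -> f x @[x --> within [set` `[a, +oo[] (nbhs t)] --> f t.
Proof.
rewrite subspace_continuousP; split=> H t.
  by move=> at_; apply: H; rewrite /= in_itv /= at_.
by rewrite /= in_itv /= andbT; apply: H.
Qed.

(** [Num.max a] maps the whole line continuously into [[a, +oo[], so composing with it turns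
    relative continuity into ordinary continuity, which the fundamental theorem of calculus needs at
    the endpoint. *)
Lemma continuous_clamp (R : realType) (a : R) (f : R -> R) :
  {within `[a, +oo[, continuous f} -> continuous (fun t => f (Num.max a t)).
Proof.
move=> /within_halfline_continuousP cf t.
apply: (cvg_trans _ (cf (Num.max a t) _)); last by rewrite le_max lexx.
move=> U; rewrite /= !nbhs_simpl /= => HU.
have : (Num.max a) @ t --> Num.max a t.
  by apply: (@continuous_max _ _ (cst a) id); [exact: cvg_cst|exact: cvg_id].
move=> /(_ _ HU); rewrite /= !nbhs_simpl => H.
apply: (@filterS _ (nbhs t) _ _ _ _ H) => x /=.
by apply; rewrite /= in_itv /= le_max lexx.
Qed.

Lemma is_derive_within_continuous (R : realType) (a : R) (f f' : R -> R) :
  (forall t, a <= t -> is_derive t (1 : R) f (f' t)) ->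
  {within `[a, +oo[, continuous f}.
Proof.
move=> df; apply/within_halfline_continuousP => t at_.
have ct : {for t, continuous f}.
  apply: differentiable_continuous; apply/derivable1_diffP.
  by have [] := df t at_.
exact: (cvg_trans (cvg_app f (@cvg_within _ _ _ _)) ct).
Qed.

(* Clamping the integrand at [a] and integrating from [a - 1] makes the
   derivative at the endpoint [a] two-sided. *)
Definition primitive (R : realType) (a : R) (f : R -> R) (x : R) : R :=
  \int[lebesgue_measure]_(t in `[a - 1, x]) f (Num.max a t) -
  \int[lebesgue_measure]_(t in `[a - 1, a]) f (Num.max a t).

Lemma primitive_base (R : realType) (a : R) (f : R -> R) : primitive a f a = 0.
Proof. exact: subrr. Qed.

Lemma is_derive_primitive (R : realType) (a : R) (f : R -> R) (t : R) :
  {within `[a, +oo[, continuous f} -> a <= t ->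
  is_derive t (1 : R) (primitive a f) (f t).
Proof.
move=> /continuous_clamp cf at_.
(* The upper limit [t + 1] serves only to make [t] interior to the interval of integration. *)
have [||||D E] := @continuous_FTC1_closed R (fun s => f (Num.max a s)) (a - 1) t (t + 1).
- by rewrite ltrDl.
- apply: continuous_compact_integrable; first exact: segment_compact.
  exact: continuous_subspaceT.
- by rewrite ltrBlDr (le_lt_trans at_)// ltrDl.
- exact: cf.
rewrite /= in D E.
have -> : f t = f (Num.max a t) - 0 by rewrite subr0 max_r.
rewrite -E derive1E; apply: is_deriveB.
by apply: derivableP.
Qed.

(** Mean value theorem for [g - f]. The growth estimates below go through this form rather than
    through integrals. *)
Lemma is_derive_le (R : realType) (f g f' g' : R -> R) (a b : R) : a <= b ->
  (forall t, a <= t <= b -> is_derive t (1 : R) f (f' t)) ->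
  (forall t, a <= t <= b -> is_derive t (1 : R) g (g' t)) ->
  (forall t, a <= t <= b -> f' t <= g' t) ->
  f b - f a <= g b - g a.
Proof.
move=> ab df dg fg.
have dh t : a <= t <= b -> is_derive t (1 : R) (g - f) (g' t - f' t).
  by move=> tab; apply: is_deriveB; [exact: dg|exact: df].
have [t| |c ] := @MVT_segment R (g - f) (fun t => g' t - f' t) a b ab.
- by rewrite in_itv /= => /andP[/ltW ? /ltW ?]; apply: dh; apply/andP.
- apply: derivable_within_continuous => t; rewrite in_itv /= => /dh tab.
  by have [] := tab.
rewrite in_itv /= => cab /eqP; rewrite !fctE => /eqP H.
have : 0 <= (g' c - f' c) * (b - a).
  by rewrite mulr_ge0 ?subr_ge0// fg.
rewrite -H; lra.
Qed.

Lemma is_derive_norm_le (R : realType) (f g f' g' : R -> R) (a b : R) : a <= b ->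
  (forall t, a <= t <= b -> is_derive t (1 : R) f (f' t)) ->
  (forall t, a <= t <= b -> is_derive t (1 : R) g (g' t)) ->
  (forall t, a <= t <= b -> `|f' t| <= g' t) ->
  `|f b - f a| <= g b - g a.
Proof.
move=> ab df dg fg; rewrite ler_norml; apply/andP; split.
  rewrite lerNl -[leLHS]opprK opprK; have -> : - (f b - f a) = (- f) b - (- f) a.
    by rewrite !fctE; lra.
  apply: (@is_derive_le R (- f) g (fun t => - f' t) g') => // t tab.
    exact: is_deriveN (df t tab).
  by have := fg t tab; rewrite ler_norml => /andP[]; rewrite lerNl.
apply: (@is_derive_le R f g f' g') => // t tab.
by have := fg t tab; rewrite ler_norml => /andP[].
Qed.

Lemma within_halfline_bounded (R : realType) (a b : R) (f : R -> R) :
  {within `[a, +oo[, continuous f} ->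
  exists2 M, 0 <= M & forall t, a <= t <= b -> `|f t| <= M.
Proof.
move=> cf; have [ab|ba] := leP a b; last first.
  by exists 0 => // t /andP[/le_trans H /H]; rewrite leNgt ba.
have cnf : {within `[a, b], continuous (fun t => `|f t|)}.
  move=> t; apply: continuous_comp; last exact: norm_continuous.
  exact/(continuous_subspaceW _ cf)/subset_itvl.
have [c _ H] := EVT_max ab cnf.
by exists `|f c| => // t tab; apply: H; rewrite in_itv.
Qed.

(** * Linear systems *)

(** The series converges absolutely by comparison with a geometric one, whose tail from index [n] on
    sums to [2 * C * 2^-1 ^+ n]. *)
Lemma halving_series (R : realType) (u : R^nat) (C : R) :
  (forall k, `|u k| <= C * 2^-1 ^+ k) ->
  forall n, `|limn (series u) - series u n| <= 2 * C * 2^-1 ^+ n.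
Proof.
move=> uC.
have C0 : 0 <= C by have := uC 0%N; rewrite expr0 mulr1; exact: le_trans.
have cu : cvgn (series u).
  apply: normed_cvg; apply: (@series_le_cvg _ _ (geometric C 2^-1)).
  - by move=> k /=.
  - by move=> k /=; rewrite mulr_ge0// exprn_ge0// invr_ge0.
  - exact: uC.
  - by apply: is_cvg_geometric_series; rewrite ger0_norm ?invr_ge0// invf_lt1// ltr1n.
move=> n.
(* Keeping the subtracted remainder on the right is what lets the induction on [m] close. *)
have tail m : `|series u (n + m)%N - series u n| <=
    2 * C * 2^-1 ^+ n - 2 * C * 2^-1 ^+ (n + m).
  elim: m => [|m IH]; first by rewrite addn0 !subrr normr0.
  rewrite addnS -(subrK (series u (n + m)%N) (series u _.+1)) -addrA.
  apply: (le_trans (ler_normD _ _)).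
  rewrite seriesSr addrAC subrr add0r.
  have := uC (n + m)%N; rewrite [_ ^+ (n + m).+1]exprS; move: IH; lra.
apply: (@cvgr_to_le _ \oo _ _ (fun m => `|series u m - series u n|)).
  by apply: cvg_norm; apply: cvgB; [exact: cu|exact: cvg_cst].
exists n => // m /= nm; rewrite -(subnKC nm); apply: (le_trans (tail _)).
by rewrite gerBl mulr_ge0// ?mulr_ge0// exprn_ge0// invr_ge0.
Qed.

Lemma halving_eps (R : realType) (C e : R) : 0 < e ->
  exists n, C * 2^-1 ^+ n <= e.
Proof.
move=> e0; have : geometric C (2^-1 : R) @ \oo --> (0 : R).
  by apply: cvg_geometric; rewrite ger0_norm ?invr_ge0// invf_lt1// ltr1n.
move=> /cvgr_dist_le/(_ _ e0)[n _ /(_ n (leqnn n))] /=.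
by rewrite sub0r normrN => /(le_trans (ler_norm _)); exists n.
Qed.

(** The usual [e / 3] argument. The constant may depend on the right end [b] because continuity at
    [t] only involves points below [t + 1]. *)
Lemma halving_uniform_limit_continuous (R : realType) (a : R)
    (s : nat -> R -> R) (f : R -> R) :
  (forall n, {within `[a, +oo[, continuous (s n)}) ->
  (forall b, exists C, forall n t, a <= t <= b ->
    `|f t - s n t| <= C * 2^-1 ^+ n) ->
  {within `[a, +oo[, continuous f}.
Proof.
move=> cs fs; apply/within_halfline_continuousP => t at_.
apply/cvgrPdist_le => e e0.
have [C HC] := fs (t + 1); have e3 : 0 < e / 3 by rewrite divr_gt0.
have [n Hn] := halving_eps C e3.
have /within_halfline_continuousP/(_ t at_)/cvgrPdist_le/(_ _ e3) := cs n.
rewrite near_withinE => H; rewrite near_withinE.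
have H1 : \forall x \near t, x < t + 1 by apply: lt_nbhsl; rewrite ltrDl.
apply: filterS2 H H1 => x Hx /ltW xt xa.
have {Hx} h3 := Hx xa; have {xa}ax : a <= x by move: xa; rewrite /= in_itv /= andbT.
have h1 : `|f t - s n t| <= e / 3.
  by apply: le_trans Hn; apply: HC; rewrite at_ lerDl ler01.
have h2 : `|f x - s n x| <= e / 3.
  by apply: le_trans Hn; apply: HC; rewrite ax xt.
have -> : f t - f x = (f t - s n t) + (s n t - s n x) - (f x - s n x) by ring.
rewrite (le_trans (ler_normB _ _))// (le_trans (lerD (ler_normD _ _) (lexx _)))//.
lra.
Qed.

Lemma is_derive_expR_affine (R : realType) (N L a t : R) :
  is_derive t (1 : R) (fun s => N * expR (L * (s - a))) (N * (L * expR (L * (t - a)))).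
Proof.
have H : is_derive t (1 : R) (fun s => L * (s - a)) L.
  apply: is_derive_eq
    (is_deriveZ L (is_deriveB (is_derive_id t 1) (is_derive_cst a t 1))) _.
  by rewrite subr0 /GRing.scale /= mulr1.
have := is_deriveZ N 
  (@is_derive1_comp _ expR (fun s => L * (s - a)) _ _ _ (is_derive_expR _) H).
by rewrite /GRing.scale /= [_ * L]mulrC.
Qed.

(** These are the terms of the Picard series: each is the integral of the coefficient matrix applied
    to the previous one, so that the partial sums are the Picard iterates. *)
Fixpoint picard_term (R : realType) (t0 : R) (a b c d : R -> R) (x0 y0 : R)
    (k : nat) : (R -> R) * (R -> R) :=
  if k is j.+1 then
    let u := picard_term t0 a b c d x0 y0 j in
    (primitive t0 (fun t => a t * u.1 t + b t * u.2 t),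
     primitive t0 (fun t => c t * u.1 t + d t * u.2 t))
  else (cst x0, cst y0).

Lemma within_continuousMD (R : realType) (A : set R) (a b f g : R -> R) :
  {within A, continuous a} -> {within A, continuous b} ->
  {within A, continuous f} -> {within A, continuous g} ->
  {within A, continuous (fun t => a t * f t + b t * g t)}.
Proof.
move=> ca cb cf cg t; apply: cvgD; apply: cvgM.
- exact: ca. - exact: cf. - exact: cb. - exact: cg.
Qed.

(** The Picard series converges uniformly on every bounded part of the half-line, so the solution is
    global without any continuation argument. Its sum satisfies the integral equation, which is then
    differentiated. *)
Lemma linear_system_solution (R : realType) (t0 : R) (a b c d : R -> R)
    (ca : {within `[t0, +oo[, continuous a})
    (cb : {within `[t0, +oo[, continuous b})
    (cc : {within `[t0, +oo[, continuous c})
    (cd : {within `[t0, +oo[, continuous d}) (x0 y0 : R) :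
  exists x y : R -> R, [/\ x t0 = x0, y t0 = y0 & forall t, t0 <= t ->
    is_derive t (1 : R) x (a t * x t + b t * y t) /\
    is_derive t (1 : R) y (c t * x t + d t * y t)].
Proof.
pose u := picard_term t0 a b c d x0 y0.
have cu k : {within `[t0, +oo[, continuous (u k).1} /\
            {within `[t0, +oo[, continuous (u k).2}.
  elim: k => [|k [c1 c2]] /=; first by split=> t; exact: cvg_cst.
  split; apply: is_derive_within_continuous => t tt; apply: is_derive_primitive => //;
  exact: within_continuousMD.
have du k t : t0 <= t ->
    is_derive t (1 : R) (u k.+1).1 (a t * (u k).1 t + b t * (u k).2 t) /\
    is_derive t (1 : R) (u k.+1).2 (c t * (u k).1 t + d t * (u k).2 t).
  move=> tt; have [c1 c2] := cu k.
  by split; apply: is_derive_primitive => //; apply: within_continuousMD.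
have bnd T : exists2 M, 0 <= M & forall t, t0 <= t <= T ->
    [/\ `|a t| <= M, `|b t| <= M, `|c t| <= M & `|d t| <= M].
  have [M1 M10 H1] := within_halfline_bounded T ca.
  have [M2 M20 H2] := within_halfline_bounded T cb.
  have [M3 M30 H3] := within_halfline_bounded T cc.
  have [M4 M40 H4] := within_halfline_bounded T cd.
  exists (M1 + M2 + M3 + M4); first by rewrite !addr_ge0.
  by move=> t tT; have := H1 t tT; have := H2 t tT; have := H3 t tT; have := H4 t tT;
     split; lra.
have lin_le M p q f g N : 0 <= M -> `|p| <= M -> `|q| <= M -> `|f| <= N -> `|g| <= N ->
    `|p * f + q * g| <= 2 * M * N :> R.
  move=> M0 pM qM fN gN; apply: (le_trans (ler_normD _ _)); rewrite !normrM.
  have -> : 2 * M * N = M * N + M * N by ring.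
  by apply: lerD; apply: ler_pM.
have term_le T : exists C, forall k t, t0 <= t <= T ->
    `|(u k).1 t| <= C * 2^-1 ^+ k /\ `|(u k).2 t| <= C * 2^-1 ^+ k.
  have [M M0 HM] := bnd T.
  pose N := `|x0| + `|y0|; have N0 : 0 <= N by rewrite addr_ge0.
  (* Against the weight [exp (4 M (t - t0))] each integration gains a factor
     [2M / 4M = 1/2]. *)
  have H k : forall t, t0 <= t <= T ->
      `|(u k).1 t| <= N * 2^-1 ^+ k * expR (4 * M * (t - t0)) /\
      `|(u k).2 t| <= N * 2^-1 ^+ k * expR (4 * M * (t - t0)).
    elim: k => [|k IH] t /andP[t0t tT].
      have : 1 <= expR (4 * M * (t - t0)).
        by rewrite -expR0 ler_expR mulr_ge0 ?mulr_ge0 ?subr_ge0.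
      rewrite expr0 mulr1 /= => E; split.
        by apply: (le_trans _ (ler_peMr _ E)) => //; rewrite lerDl.
      by apply: (le_trans _ (ler_peMr _ E)) => //; rewrite lerDr.
    have key (v v' : R -> R) : v t0 = 0 ->
        (forall s, t0 <= s <= t -> is_derive s (1 : R) v (v' s)) ->
        (forall s, t0 <= s <= t -> `|v' s| <=
           2 * M * (N * 2^-1 ^+ k * expR (4 * M * (s - t0)))) ->
        `|v t| <= N * 2^-1 ^+ k.+1 * expR (4 * M * (t - t0)).
      move=> v0 dv v'le.
      have := is_derive_norm_le t0t dv
        (fun s _ => is_derive_expR_affine (N * 2^-1 ^+ k.+1) (4 * M) t0 s).
      rewrite v0 subr0 => /(_ _)/le_trans; apply.
        move=> s st; apply: (le_trans (v'le s st)); rewrite exprS.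
        by rewrite le_eqVlt; apply/orP; left; apply/eqP; field.
      by rewrite gerBl mulr_ge0 ?mulr_ge0 ?expR_ge0// exprn_ge0// invr_ge0.
    have IH' s : t0 <= s <= t -> t0 <= s <= T.
      by move=> /andP[-> /le_trans]; apply.
    split.
      apply: (key _ (fun s => a s * (u k).1 s + b s * (u k).2 s)).
    - exact: primitive_base.
    - by move=> s /andP[/(du k)[]].
    - by move=> s /IH' st; have [? ? ? ?] := HM s st; have [? ?] := IH s st; exact: lin_le.
    apply: (key _ (fun s => c s * (u k).1 s + d s * (u k).2 s)).
    - exact: primitive_base.
    - by move=> s /andP[/(du k)[]].
    - by move=> s /IH' st; have [? ? ? ?] := HM s st; have [? ?] := IH s st; exact: lin_le.
  exists (N * expR (4 * M * (T - t0))) => k t tT; have [H1 H2] := H k t tT.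
  have E : N * 2^-1 ^+ k * expR (4 * M * (t - t0)) <=
      N * expR (4 * M * (T - t0)) * 2^-1 ^+ k.
    rewrite mulrAC; apply: ler_wpM2r; first by rewrite exprn_ge0// invr_ge0.
    apply: ler_wpM2l => //; rewrite ler_expR; apply: ler_wpM2l; first by rewrite mulr_ge0.
    by case/andP: tT => _; rewrite lerD2r.
  by split; [exact: le_trans H1 E|exact: le_trans H2 E].
pose s1 n t := series (fun k => (u k).1 t) n.
pose s2 n t := series (fun k => (u k).2 t) n.
pose x t := limn (series (fun k => (u k).1 t)).
pose y t := limn (series (fun k => (u k).2 t)).
have xs T : exists C, forall n t, t0 <= t <= T -> `|x t - s1 n t| <= C * 2^-1 ^+ n.
  have [C HC] := term_le T; exists (2 * C) => n t tT.
  by apply: halving_series => k; have [] := HC k t tT.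
have ys T : exists C, forall n t, t0 <= t <= T -> `|y t - s2 n t| <= C * 2^-1 ^+ n.
  have [C HC] := term_le T; exists (2 * C) => n t tT.
  by apply: halving_series => k; have [] := HC k t tT.
have sS (v : nat -> R -> R) n : (fun t => series (fun k => v k t) n.+1) =
    (fun t => series (fun k => v k t) n) + v n.
  by apply/funext => t; rewrite !fctE seriesSr.
have s0 (v : nat -> R -> R) : (fun t => series (fun k => v k t) 0) = cst 0.
  by apply/funext => t; rewrite /series /= big_geq.
have cs1 n : {within `[t0, +oo[, continuous (s1 n)}.
  rewrite /s1; elim: n => [|n IH]; first by rewrite s0 => t; exact: cvg_cst.
  by rewrite sS => t; apply: cvgD; [exact: IH|exact: (cu n).1].
have cs2 n : {within `[t0, +oo[, continuous (s2 n)}.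
  rewrite /s2; elim: n => [|n IH]; first by rewrite s0 => t; exact: cvg_cst.
  by rewrite sS => t; apply: cvgD; [exact: IH|exact: (cu n).2].
have cx := halving_uniform_limit_continuous cs1 xs.
have cy := halving_uniform_limit_continuous cs2 ys.
(* The shift is that of the Picard iterates: partial sum [n.+1] has as derivative the right-hand
   side evaluated at partial sum [n]. For [n = 0] both sides vanish, partial sum [1] being
   constant. *)
have ds n t : t0 <= t ->
    is_derive t (1 : R) (s1 n.+1) (a t * s1 n t + b t * s2 n t) /\
    is_derive t (1 : R) (s2 n.+1) (c t * s1 n t + d t * s2 n t).
  move=> tt; rewrite /s1 /s2; elim: n => [|n [IH1 IH2]].
    rewrite !sS !s0 /series /= !big_geq// !mulr0 !addr0.
    by split; apply: is_derive_eq (is_deriveD (is_derive_cst _ _ _)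
      (is_derive_cst _ _ _)) _; rewrite addr0.
  have [d1 d2] := du n t tt; rewrite [in X in is_derive _ _ X]sS.
  rewrite [in X in _ /\ is_derive _ _ X _]sS; split.
    apply: is_derive_eq (is_deriveD IH1 d1) _; rewrite !seriesSr; ring.
  apply: is_derive_eq (is_deriveD IH2 d2) _; rewrite !seriesSr; ring.
(* Passage to the limit in the integral equation, once for both components: [w n.+1] and [z0 + P]
   agree at [t0] and their derivatives differ by a multiple of [2^-1 ^+ n]. *)
have key (p q z : R -> R) (z0 : R) (w : nat -> R -> R) :
    {within `[t0, +oo[, continuous p} -> {within `[t0, +oo[, continuous q} ->
    (forall T, exists2 M, 0 <= M & forall t, t0 <= t <= T -> `|p t| <= M /\ `|q t| <= M) ->
    (forall T, exists C, forall n t, t0 <= t <= T -> `|z t - w n t| <= C * 2^-1 ^+ n) ->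
    (forall n, w n.+1 t0 = z0) ->
    (forall n t, t0 <= t -> is_derive t (1 : R) (w n.+1) (p t * s1 n t + q t * s2 n t)) ->
    forall t, t0 <= t -> z t = z0 + primitive t0 (fun t => p t * x t + q t * y t) t.
  move=> cp cq pq zw w0 dw t tt; set P := primitive _ _.
  have [M M0 HM] := pq t; have [C1 HC1] := xs t; have [C2 HC2] := ys t.
  have [C3 HC3] := zw t.
  pose C4 := `|C1| + `|C2|.
  have wP n : `|w n.+1 t - (z0 + P t)| <= 2 * M * C4 * (t - t0) * 2^-1 ^+ n.
    have := @is_derive_norm_le R (w n.+1 - P) (fun s => 2 * M * (C4 * 2^-1 ^+ n) * s)
      (fun s => (p s * s1 n s + q s * s2 n s) - (p s * x s + q s * y s))
      (fun s => 2 * M * (C4 * 2^-1 ^+ n)) t0 t tt.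
    have -> : (w n.+1 - P) t - (w n.+1 - P) t0 = w n.+1 t - (z0 + P t).
      by rewrite !fctE w0 [P t0]primitive_base; ring.
    move=> H; apply: (le_trans (H _ _ _)); last by rewrite le_eqVlt; apply/orP; left; apply/eqP; ring.
    - move=> s /andP[ts _]; apply: is_deriveB; first exact: dw.
      by apply: is_derive_primitive => //; apply: within_continuousMD.
    - move=> s _; apply: is_derive_eq (is_deriveZ (2 * M * (C4 * 2^-1 ^+ n)) (is_derive_id s 1)) _.
      by rewrite /GRing.scale /= mulr1.
    - move=> s st; have [ps qs] := HM s st.
      have -> : p s * s1 n s + q s * s2 n s - (p s * x s + q s * y s) =
          p s * (s1 n s - x s) + q s * (s2 n s - y s) by ring.
      have h0 : 0 <= (2^-1 : R) ^+ n by rewrite exprn_ge0// invr_ge0.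
      apply: lin_le => //; rewrite distrC.
        apply: (le_trans (HC1 n s st)); apply: ler_wpM2r => //.
        by rewrite (le_trans (ler_norm _))// lerDl.
      apply: (le_trans (HC2 n s st)); apply: ler_wpM2r => //.
      by rewrite (le_trans (ler_norm _))// lerDr.
  apply/eqP; rewrite -subr_eq0 -normr_le0; apply/ler_addgt0Pr => e e0; rewrite add0r.
  (* [C3] is halved because [z] is compared with [w n.+1], one index further than the bound
     [wP n]. *)
  have [n Hn] := halving_eps (C3 / 2 + 2 * M * C4 * (t - t0)) e0.
  apply: le_trans Hn; rewrite -(subrK (w n.+1 t) (z t)) -addrA.
  apply: (le_trans (ler_normD _ _)); rewrite mulrDl; apply: lerD => //.
  have := HC3 n.+1 t; rewrite exprS mulrA; apply.
  by rewrite tt lexx.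
have s1t0 n : s1 n.+1 t0 = x0.
  rewrite /s1; elim: n => [|n IH]; first by rewrite seriesSr /series /= big_geq ?add0r.
  by rewrite seriesSr IH [X in _ + X]primitive_base addr0.
have s2t0 n : s2 n.+1 t0 = y0.
  rewrite /s2; elim: n => [|n IH]; first by rewrite seriesSr /series /= big_geq ?add0r.
  by rewrite seriesSr IH [X in _ + X]primitive_base addr0.
have xE : forall t, t0 <= t -> x t = x0 + primitive t0 (fun t => a t * x t + b t * y t) t.
  apply: (key a b x x0 s1) => //.
  - by move=> T; have [M M0 HM] := bnd T; exists M => // t /HM[].
  - by move=> n t /(ds n)[].
have yE : forall t, t0 <= t -> y t = y0 + primitive t0 (fun t => c t * x t + d t * y t) t.
  apply: (key c d y y0 s2) => //.
  - by move=> T; have [M M0 HM] := bnd T; exists M => // t /HM[].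
  - by move=> n t /(ds n)[].
(* The witnesses are the integral expressions rather than [x] and [y]: the two agree only from [t0]
   on, whereas a two-sided derivative at [t0] also involves values to its left. *)
exists (cst x0 + primitive t0 (fun t => a t * x t + b t * y t)).
exists (cst y0 + primitive t0 (fun t => c t * x t + d t * y t)).
split.
- by rewrite fctE primitive_base addr0.
- by rewrite fctE primitive_base addr0.
move=> t tt; rewrite !fctE /= -xE// -yE//.
by split; (apply: is_derive_eq (is_deriveD (is_derive_cst _ _ _)
  (is_derive_primitive _ _)) _; [exact: within_continuousMD|exact: tt|exact: add0r]).
Qed.

(** * The scalar Riccati inequality *)

Lemma is_derive_mul (R : realType) (f g : R -> R) (t f' g' : R) :
  is_derive t (1 : R) f f' -> is_derive t (1 : R) g g' ->
  is_derive t (1 : R) (fun s => f s * g s) (f' * g t + f t * g').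
Proof.
move=> df dg; apply: is_derive_eq (is_deriveM df dg) _.
by rewrite /GRing.scale /= addrC mulrC.
Qed.

(** The two solutions that start at [t0] from the unit vectors form a fundamental matrix; it is
    invertible at [T], so a combination of its columns takes the data prescribed there. *)
Lemma linear_system_initial_value_at (R : realType) (t0 T : R) (p q mu : R -> R)
    (cp : {within `[t0, +oo[, continuous p})
    (cq : {within `[t0, +oo[, continuous q})
    (cmu : {within `[t0, +oo[, continuous mu}) (yT : R) : t0 <= T ->
  exists phi psi : R -> R, [/\ phi T = 1, psi T = yT & forall t, t0 <= t ->
    is_derive t (1 : R) phi (mu t * phi t + p t * psi t) /\
    is_derive t (1 : R) psi (- q t * phi t + - mu t * psi t)].
Proof.
move=> t0T.
have cN (f : R -> R) : {within `[t0, +oo[, continuous f} ->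
    {within `[t0, +oo[, continuous (fun t => - f t)}.
  by move=> cf t; apply: cvgN; exact: cf.
have [x1 [y1 [x10 y10 d1]]] := linear_system_solution cmu cp (cN _ cq) (cN _ cmu) 1 0.
have [x2 [y2 [x20 y20 d2]]] := linear_system_solution cmu cp (cN _ cq) (cN _ cmu) 0 1.
(* The coefficient matrix is traceless, so the Wronskian is constant. *)
have W : x1 T * y2 T - x2 T * y1 T = 1.
  have := @is_derive_norm_le R (fun t => x1 t * y2 t - x2 t * y1 t) (cst 0)
    (fun=> 0) (cst 0) t0 T t0T.
  rewrite /cst /= subrr x10 y10 x20 y20 mulr0 subr0 mulr1 => H.
  apply/eqP; rewrite -subr_eq0 -normr_le0; apply: H => [t /andP[tt _]|t _].
  - have [dx1 dy1] := d1 t tt; have [dx2 dy2] := d2 t tt.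
    apply: is_derive_eq (is_deriveB (is_derive_mul dx1 dy2)
      (is_derive_mul dx2 dy1)) _; ring.
  - by rewrite normr0.
have lincomb (u v : R -> R) (m n t u' v' : R) : is_derive t (1 : R) u u' ->
    is_derive t (1 : R) v v' ->
    is_derive t (1 : R) (fun s => m * u s + n * v s) (m * u' + n * v').
  by move=> du dv; exact: (is_deriveD (is_deriveZ m du) (is_deriveZ n dv)).
(* Cramer's rule for the data [(1, yT)], the determinant being [1] by [W]. *)
pose m := y2 T - yT * x2 T; pose n := yT * x1 T - y1 T.
exists (fun t => m * x1 t + n * x2 t), (fun t => m * y1 t + n * y2 t); split.
- by rewrite -W /m /n; ring.
- by rewrite -[RHS]mulr1 -W /m /n; ring.
move=> t tt; have [dx1 dy1] := d1 t tt; have [dx2 dy2] := d2 t tt; split.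
  by apply: is_derive_eq (lincomb _ _ _ _ _ _ _ dx1 dx2) _; ring.
by apply: is_derive_eq (lincomb _ _ _ _ _ _ _ dy1 dy2) _; ring.
Qed.

Lemma riccati_inequality_nonoscillation (R : realType) (t0 T : R)
    (p q mu y y' : R -> R)
    (cp : {within `[t0, +oo[, continuous p})
    (cq : {within `[t0, +oo[, continuous q})
    (cmu : {within `[t0, +oo[, continuous mu}) : t0 <= T ->
  (forall t, T <= t -> 0 <= p t) ->
  (forall t, T <= t -> is_derive t (1 : R) y (y' t)) ->
  (forall t, T <= t -> y' t + p t * y t ^+ 2 + 2 * mu t * y t + q t <= 0) ->
  exists phi psi : R -> R,
    (forall t, t0 <= t ->
      is_derive t (1 : R) phi (mu t * phi t + p t * psi t) /\
      is_derive t (1 : R) psi (- q t * phi t + - mu t * psi t)) /\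
    (forall t, T <= t -> phi t != 0).
Proof.
move=> t0T p0 dy ricc.
have [phi [psi [phiT psiT dphi]]] :=
  linear_system_initial_value_at cp cq cmu (y T) t0T.
exists phi, psi; split=> // b Tb.
(* [w] is the defect in the Riccati substitution [psi = y * phi], and [r] is the slack in the
   assumed inequality, non-negative from [T] on. *)
pose w t := psi t - y t * phi t.
pose r t := - (y' t + p t * y t ^+ 2 + 2 * mu t * y t + q t).
have dw t : T <= t ->
    is_derive t (1 : R) w (- (mu t + p t * y t) * w t + r t * phi t).
  move=> Tt; have [d1 d2] := dphi t (le_trans t0T Tt).
  apply: is_derive_eq (is_deriveB d2 (is_derive_mul (dy t Tt) d1)) _.
  by rewrite /w /r; ring.
have wT : w T = 0 by rewrite /w psiT phiT mulr1 subrr.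
have phiw t : T <= t -> 0 <= phi t * w t.
  move=> Tt; have := @is_derive_le R (cst 0) (fun t => phi t * w t) (cst 0)
    (fun t => p t * w t ^+ 2 + r t * phi t ^+ 2) T t Tt.
  rewrite /cst /= wT mulr0 !subr0; apply=> s /andP[Ts _].
  - have [d1 _] := dphi s (le_trans t0T Ts).
    apply: is_derive_eq (is_derive_mul d1 (dw s Ts)) _.
    by rewrite /w /r; ring.
  - by rewrite addr_ge0// mulr_ge0 ?sqr_ge0 ?p0// oppr_ge0 ricc.
have cmupy : {within `[T, +oo[, continuous (fun t => mu t * 1 + p t * y t)}.
  apply: within_continuousMD.
  - exact/(continuous_subspaceW _ cmu)/subset_itvr.
  - exact/(continuous_subspaceW _ cp)/subset_itvr.
  - by move=> t; exact: cvg_cst.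
  - exact: is_derive_within_continuous dy.
(* [K] bounds [mu + p * y] in absolute value on [[T, b]]. The weight [expR (2 * K * (t - T))]
   therefore makes the square of [phi] nondecreasing there, and it starts from [1] at [T]. *)
have [K K0 HK] := within_halfline_bounded b cmupy.
have := @is_derive_le R (cst 0) (fun t => phi t * phi t * (1 * expR (2 * K * (t - T))))
  (cst 0) (fun t => (2 * ((mu t + p t * y t) + K) * phi t ^+ 2 + 2 * p t * (phi t * w t))
    * expR (2 * K * (t - T))) T b Tb.
rewrite /cst /= phiT !subrr !mulr0 expR0 !mulr1 => H.
have {H} : 0 <= phi b * phi b * (1 * expR (2 * K * (b - T))) - 1.
  apply: H => s /andP[Ts sb].
  - have [d1 _] := dphi s (le_trans t0T Ts).
    apply: is_derive_eq (is_derive_mul (is_derive_mul d1 d1)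
      (is_derive_expR_affine 1 (2 * K) T s)) _.
    by rewrite /w /r; ring.
  - apply: mulr_ge0; last exact: expR_ge0.
    have := HK s; rewrite Ts sb mulr1 ler_norml => /(_ isT)/andP[Ks _].
    apply: addr_ge0; last by rewrite mulr_ge0 ?phiw// mulr_ge0 ?p0.
    by rewrite mulr_ge0 ?sqr_ge0// mulr_ge0//; move: Ks; lra.
by apply: contraTneq => ->; rewrite !mul0r -ltNge; lra.
Qed.

(** * Two-sided derivatives and derivatives relative to the half-line *)

Lemma dnbhs_quotientP (R : realType) (f : R -> R) (t l : R) :
  quotient f t x @[x --> t^'] --> l <-> is_derive t (1 : R) f l.
Proof.
suff H : quotient f t x @[x --> t^'] --> l <->
    (fun h => h^-1 *: ((f \o shift t) (h *: 1) - f t)) @ (0 : R)^' --> l.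
  split=> [/H D|[D E]].
    by split; [apply/cvg_ex; exists l|exact: cvg_lim].
  by apply/H; rewrite -E.
split=> /cvgrPdist_le D; apply/cvgrPdist_le => e /D; rewrite !near_withinE => H.
  have {}H : \forall x \near t, x != t -> `|l - quotient f t x| <= e by exact: H.
  apply: filterS ((nbhs0P _ _).1 H) => h /=; rewrite /GRing.scale /= mulr1 [t + h]addrC.
  by rewrite /quotient /= addrK => K h0; apply: K; rewrite -subr_eq0 addrK.
have {}H : \forall x \near t, x != t -> `|l - quotient f t x| <= e; last exact: H.
apply/nbhs0P; apply: filterS H => h /=; rewrite /GRing.scale /= mulr1.
rewrite [t + h]addrC /quotient /= addrK => K h0; apply: K.
by move: h0; rewrite -subr_eq0 addrK.
Qed.

(** The half-line contains a right neighbourhood of each of its points, [t0] included. Properness is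
    what makes limits along this filter unique. *)
Lemma punctured_nbhs_filter (R : realType) (t0 t : R) :
  t0 <= t -> ProperFilter (punctured_nbhs t0 t).
Proof.
move=> tt; apply: Build_ProperFilter_ex => P; rewrite /punctured_nbhs => HP.
have : \forall x \near t^'+, P x.
  move: HP; rewrite /within /= !near_withinE; apply: filterS => x + tx.
  by apply; [rewrite gt_eqF|rewrite in_itv /= (le_trans tt)// ltW].
by move=> H; exact: (@filter_ex _ _ (at_right_proper_filter t) P H).
Qed.

Lemma punctured_nbhs_interior (R : realType) (t0 t : R) :
  t0 < t -> punctured_nbhs t0 t = t^'.
Proof.
move=> tt; apply/seteqP; split=> P; rewrite /punctured_nbhs /within /=; last first.
  by apply: filterS => x ? ?.
have H : \forall x \near t^', t0 < x by apply: nbhs_dnbhs; exact: lt_nbhsr.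
apply: filterS2 H => x t0x; apply; rewrite in_itv /= ltW//.
Qed.

(** A two-sided limit restricts to the coarser requirement of the relative filter; this carries the
    solutions built above over to the derivative used in [scalar_solution]. *)
Lemma is_derive_deriv_at (R : realType) (t0 : R) (f f' : R -> R) :
  (forall t, t0 <= t -> is_derive t (1 : R) f (f' t)) ->
  has_deriv t0 f /\ forall t, t0 <= t -> deriv_at t0 f t = f' t.
Proof.
move=> df.
have H t : t0 <= t -> quotient f t x @[x --> punctured_nbhs t0 t] --> f' t.
  move=> /df/dnbhs_quotientP; apply: cvg_trans.
  exact: (cvg_app _ (@cvg_within _ _ _ _)).
split=> t tt; first by apply/cvg_ex; exists (f' t); exact: H.
have := punctured_nbhs_filter tt => PF.
by apply: cvg_lim; [exact: Rhausdorff|exact: H].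
Qed.

(** * Hermitian forms and the least eigenvalue *)

Lemma conj_form_diag (C : numClosedFieldType) (n : nat) (d : 'rV[C]_n) (w : 'cV[C]_n) :
  (w ^t* *m diag_mx d *m w) 0 0 = \sum_i d 0 i * `|w i 0| ^+ 2.
Proof.
rewrite -mulmxA mxE; apply: eq_bigr => i _.
by rewrite mul_diag_mx !mxE normCKC mulrCA.
Qed.

Lemma conj_form1 (C : numClosedFieldType) (n : nat) (w : 'cV[C]_n) :
  (w ^t* *m w) 0 0 = \sum_i `|w i 0| ^+ 2.
Proof. by rewrite mxE; apply: eq_bigr => i _; rewrite !mxE normCKC. Qed.

Lemma conj_form1_ge0 (C : numClosedFieldType) (n : nat) (w : 'cV[C]_n) :
  0 <= (w ^t* *m w) 0 0.
Proof. by rewrite conj_form1 sumr_ge0// => i _; rewrite exprn_ge0. Qed.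

Lemma conj_form1_gt0 (C : numClosedFieldType) (n : nat) (w : 'cV[C]_n) :
  w != 0 -> 0 < (w ^t* *m w) 0 0.
Proof.
move=> u0; rewrite lt_def conj_form1_ge0 andbT conj_form1.
apply: contra u0 => /eqP/psumr_eq0P => u0; apply/eqP/colP => i.
have /eqP := u0 (fun i _ => exprn_ge0 2 (normr_ge0 (w i 0))) i isT.
by rewrite expf_eq0 normr_eq0 mxE => /eqP.
Qed.

(** Unitary diagonalisation: the substitution [w = P *m v] preserves the norm and turns the form
    into a sum of the [|w i|^2] weighted by the diagonal entries, the smallest of which is [l]. *)
Lemma hermitian_Rayleigh (C : numClosedFieldType) (n : nat) (H : 'M[C]_n) :
  (0 < n)%N -> H = H ^t* ->
  exists l, [/\ l \is Num.real, eigenvalue H l &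
    forall v : 'cV[C]_n, l * (v ^t* *m v) 0 0 <= (v ^t* *m H *m v) 0 0].
Proof.
move=> n0 hH.
have Hh : H \is hermsymmx by apply/is_hermitianmxP; rewrite expr0 scale1r.
have /orthomx_spectralP HE := hermitian_normalmx Hh.
have Du := spectral_unitarymx H; have Dr := hermitian_spectral_diag_real Hh.
have Pu := spectral_unit H.
move: (spectralmx H) (spectral_diag H) HE Du Dr Pu => P d HE Du Dr Pu.
have dr i : d 0 i \is Num.real by move/mxOverP: Dr.
case: (@real_arg_minP _ _ (Ordinal n0) xpredT (fun i => d 0 i) isT) => // i0 _ i0min.
exists (d 0 i0); split=> //.
  (* Row [i0] of [P] is a left eigenvector, nonzero because [P] is invertible. *)
  apply/eigenvalueP; exists (row i0 P).
    by rewrite -row_mul HE !mulmxA mulmxV// mul1mx; apply/rowP => j; rewrite mul_diag_mx !mxE.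
  apply/eqP => r0; have /rowP/(_ i0) : row i0 (P *m invmx P) = 0.
    by rewrite row_mul r0 mul0mx.
  by rewrite mulmxV// !mxE eqxx => /eqP; rewrite oner_eq0.
move=> v.
have -> : v ^t* *m H *m v = (P *m v) ^t* *m diag_mx d *m (P *m v).
  by rewrite trmx_mul map_mxM -invmx_unitary// HE !mulmxA.
have -> : v ^t* *m v = (P *m v) ^t* *m (P *m v).
  by rewrite trmx_mul map_mxM -(invmx_unitary Du) !mulmxA mulmxKV.
rewrite conj_form_diag conj_form1 mulr_sumr; apply: ler_sum => i _.
by apply: ler_wpM2r; [rewrite exprn_ge0|exact: i0min].
Qed.

Lemma least_eigenvalueP (R : realType) (n : nat) (H : 'M[R[i]]_n) :
  (0 < n)%N -> H = H ^t* ->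
  (exists2 u : 'cV[R[i]]_n, u != 0 &
    H *m u = (least_eigenvalue H)%:C *: u) /\
  forall v : 'cV[R[i]]_n,
    (least_eigenvalue H)%:C * (v ^t* *m v) 0 0 <= (v ^t* *m H *m v) 0 0.
Proof.
move=> n0 hH; have [l [lr le lmin]] := hermitian_Rayleigh n0 hH.
(* [eigenvalue] speaks of row vectors; since [H] is hermitian and [k] real, the conjugate transpose
   of such a row is a column eigenvector. *)
have eigen_col (k : R) : eigenvalue H k%:C ->
    exists2 u : 'cV[R[i]]_n, u != 0 & H *m u = k%:C *: u.
  move=> /eigenvalueP[u uH u0]; exists (u ^t*).
    apply: contra u0 => /eqP u0; apply/eqP/matrixP => i j.
    by have /matrixP/(_ j i) := u0; rewrite !mxE => /eqP; rewrite conjC_eq0 => /eqP.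
  have := congr1 (fun M => M ^t*) uH; rewrite /= trmx_mul map_mxM -hH => ->.
  by apply/matrixP => i j; rewrite !mxE rmorphM/= [X in X * _]conj_Creal// realE !lecR le_total.
have lE : l = (complex.Re l)%:C by rewrite RRe_real.
(* The Rayleigh bound at an eigenvector shows that [l] is the least eigenvalue, so the set is
   inhabited and [xget] does not return its default [0]. *)
have rayleigh : [set l : R | eigenvalue H l%:C /\
    forall k : R, eigenvalue H k%:C -> l <= k] (complex.Re l).
  rewrite /= -lE; split=> // k /eigen_col[u u0 uH].
  have := lmin u; rewrite -mulmxA uH -scalemxAr [X in _ <= X]mxE.
  by rewrite ler_pM2r ?conj_form1_gt0// lE lecR.
have [e_le le_e] : [set l : R | eigenvalue H l%:C /\
    forall k : R, eigenvalue H k%:C -> l <= k] (least_eigenvalue H).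
  exact: (xgetPex 0 (ex_intro _ _ rayleigh)).
split; first exact: eigen_col.
move=> v; apply: le_trans (lmin v); apply: ler_wpM2r; first exact: conj_form1_ge0.
have : least_eigenvalue H <= complex.Re l by apply: le_e; rewrite -lE; exact: le.
by rewrite -lecR -lE.
Qed.

(** Each product [|w i| * |w j|] is at most the squared norm of [w]; the sum of the moduli of the
    entries stands in for the operator norm. *)
Lemma conj_form_norm_le (C : numClosedFieldType) (n : nat) (E : 'M[C]_n) (w : 'cV[C]_n) :
  `|(w ^t* *m E *m w) 0 0| <= (\sum_i \sum_j `|E i j|) * (w ^t* *m w) 0 0.
Proof.
have wi i : `|w i 0| ^+ 2 <= (w ^t* *m w) 0 0.
  by rewrite conj_form1 (bigD1 i)//= lerDl sumr_ge0// => j _; rewrite exprn_ge0.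
have wij i j : `|w i 0| * `|w j 0| <= (w ^t* *m w) 0 0.
  rewrite -(@ler_pXn2r _ 2)// ?nnegrE ?mulr_ge0 ?conj_form1_ge0// exprMn [X in _ <= X]expr2.
  by apply: ler_pM => //; exact: exprn_ge0.
move: ((w ^t* *m w) 0 0) wij => u wij.
rewrite -mulmxA mxE mulr_suml; apply: (le_trans (ler_norm_sum _ _ _)).
apply: ler_sum => i _; rewrite !mxE normrM norm_conjC mulr_suml.
apply: le_trans (_ : \sum_j `|w i 0| * (`|E i j| * `|w j 0|) <= _).
  rewrite -mulr_sumr; apply: ler_wpM2l => //; apply: (le_trans (ler_norm_sum _ _ _)).
  by apply: ler_sum => j _; rewrite normrM.
by apply: ler_sum => j _; rewrite mulrCA ler_wpM2l.
Qed.

(** The form of [G] is tested on an eigenvector [u] of [H] for its least eigenvalue. Exchanging [G]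
    and [H] gives the opposite bound, hence Lipschitz continuity. *)
Lemma least_eigenvalue_sub_le (R : realType) (n : nat) (G H : 'M[R[i]]_n) :
  (0 < n)%N -> G = G ^t* -> H = H ^t* ->
  (least_eigenvalue G - least_eigenvalue H)%:C <= \sum_i \sum_j `|(G - H) i j|.
Proof.
move=> n0 hG hH.
have [[u u0 uH] _] := least_eigenvalueP n0 hH.
have [_ leG] := least_eigenvalueP n0 hG.
have uu := conj_form1_gt0 u0.
rewrite -(ler_pM2r uu); apply: le_trans (conj_form_norm_le _ _).
rewrite rmorphB mulrBl.
have -> : (u ^t* *m (G - H) *m u) 0 0 =
    (u ^t* *m G *m u) 0 0 - (least_eigenvalue H)%:C * (u ^t* *m u) 0 0.
  rewrite mulmxBr mulmxBl [LHS]mxE; congr (_ + _); rewrite [LHS]mxE -mulmxA uH.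
  by rewrite -scalemxAr [X in - X]mxE.
have le1 := leG u.
apply: (@le_trans _ _ ((u ^t* *m G *m u) 0 0 - (least_eigenvalue H)%:C * (u ^t* *m u) 0 0)).
  by rewrite lerD2r.
apply: real_ler_norm; apply: rpredB; last first.
  by rewrite rpredM// ?(gtr0_real uu)// complex_real.
(* The form of [G] at [u] is real because it is comparable with a real number. *)
rewrite -(ler_real le1).
by rewrite rpredM// ?(gtr0_real uu)// complex_real.
Qed.

Lemma least_eigenvalue_ge0 (R : realType) (n : nat) (H : 'M[R[i]]_n) :
  (0 < n)%N -> nonneg_definite H -> 0 <= least_eigenvalue H.
Proof.
move=> n0 [hH H0].
have [[u u0 uH] _] := least_eigenvalueP n0 (esym hH).
have := H0 u; rewrite -mulmxA uH -scalemxAr [X in _ <= X]mxE.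
by rewrite pmulr_lge0 ?conj_form1_gt0// (lecR 0).
Qed.

Lemma mxtrace_conj_form (C : numClosedFieldType) (n : nat) (H Z : 'M[C]_n) :
  \tr (Z ^t* *m H *m Z) = \sum_j ((col j Z) ^t* *m H *m col j Z) 0 0.
Proof.
apply: eq_bigr => j _; rewrite -!mulmxA mxE [RHS]mxE; apply: eq_bigr => i _.
by rewrite !mxE; congr (_ * _); apply: eq_bigr => k _; rewrite !mxE.
Qed.

(** The Rayleigh bound on each column of [Z] gives [least_eigenvalue H * \tr (Z *m Z)]. As this
    factor is non-negative, it remains to bound the square of the trace by [n * \tr (Z *m Z)]. *)
Lemma mxtrace_quadratic_le (R : realType) (n : nat) (H Z : 'M[R[i]]_n) :
  (0 < n)%N -> nonneg_definite H -> Z = Z ^t* ->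
  least_eigenvalue H / n%:R * complex.Re (\tr Z) ^+ 2 <=
  complex.Re (\tr (Z *m H *m Z)).
Proof.
move=> n0 hH hZ; have l0 := least_eigenvalue_ge0 n0 hH.
case: hH => hH _; have [_ leH] := least_eigenvalueP n0 (esym hH).
have sq_ge0 (Y : 'M[R[i]]_n) : 0 <= complex.Re (\tr (Y ^t* *m Y)).
  rewrite -(lecR 0) RRe_real; last first.
    apply: ger0_real; rewrite -[Y ^t*]mulmx1 mxtrace_conj_form sumr_ge0// => j _.
    by rewrite mulmx1 conj_form1_ge0.
  rewrite -[Y ^t*]mulmx1 mxtrace_conj_form sumr_ge0// => j _.
  by rewrite mulmx1 conj_form1_ge0.
have H1 : least_eigenvalue H * complex.Re (\tr (Z *m Z)) <= complex.Re (\tr (Z *m H *m Z)).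
  have : (least_eigenvalue H)%:C * \tr (Z *m Z) <= \tr (Z *m H *m Z).
    have -> : \tr (Z *m Z) = \sum_j ((col j Z) ^t* *m col j Z) 0 0.
      rewrite [in LHS](_ : Z *m Z = Z ^t* *m 1%:M *m Z); last by rewrite mulmx1 -hZ.
      by rewrite mxtrace_conj_form; apply: eq_bigr => j _; rewrite mulmx1.
    rewrite [in leRHS](_ : Z *m H *m Z = Z ^t* *m H *m Z); last by rewrite -hZ.
    rewrite mxtrace_conj_form mulr_sumr.
    by apply: ler_sum => j _; exact: leH.
  by rewrite lecE => /andP[_]; case: (\tr (Z *m Z)) => a b /=; rewrite mul0r subr0.
apply: le_trans H1; rewrite -mulrA; apply: ler_wpM2l => //.
(* [c] is the mean of the eigenvalues of [Z]; expanding [\tr ((Z - c%:C%:M) *m (Z - c%:C%:M)) >= 0]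
   is the Cauchy-Schwarz inequality for them. *)
pose c : R := complex.Re (\tr Z) / n%:R.
have n0' : (n%:R : R) != 0 by rewrite pnatr_eq0 -lt0n.
have := sq_ge0 (Z - c%:C%:M).
have -> : (Z - c%:C%:M) ^t* = Z - c%:C%:M.
  rewrite [in RHS]hZ; apply/matrixP => i j; rewrite !mxE rmorphB eq_sym; congr (_ - _).
  by case: eqP => _; rewrite ?mulr1n ?mulr0n /= ?rmorph0//= conj_Creal// complex_real.
rewrite mulmxBr !mulmxBl -scalar_mxM mul_scalar_mx mul_mx_scalar.
rewrite !raddfB /= !mxtraceZ mxtrace_scalar /=.
case: (\tr Z) @c => a b c /=.
have -> : complex.Re ((c%:C * c%:C) *+ n) = c * c * n%:R.
  by rewrite -rmorphM -rmorphMn /= mulr_natr.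
rewrite /c /=; move: (complex.Re _) => s; rewrite !mul0r !subr0 => Hs.
rewrite -subr_ge0; apply: le_trans Hs _; rewrite le_eqVlt; apply/orP; left.
by apply/eqP; field.
Qed.

(** * Limits of complex matrices *)

(** A positive element of [R[i]] is real, so real tolerances suffice. *)
Lemma complex_cvgP (R : realType) (F : set_system R) (FF : Filter F)
    (f : R -> R[i]) (a : R[i]) :
  f @ F --> a <-> forall e : R, 0 < e -> \forall x \near F, `|a - f x| <= e%:C.
Proof.
split=> [fa e e0|H].
  have e0' : 0 < e%:C by rewrite ltcR.
  exact: (@cvgrPdist_le R[i] R[i]^o R F FF f a).1 fa _ e0'.
apply/(@cvgrPdist_le R[i] R[i]^o R F FF f a) => e e0.
have -> : e = (complex.Re e)%:C.
  by move: e0; rewrite ltcE /= => /andP[/eqP e0 _]; case: e e0 => ? ? /= ->.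
by apply: H; move: e0; rewrite ltcE /= => /andP[].
Qed.

Lemma cvg_Re (R : realType) (F : set_system R) (FF : Filter F)
    (f : R -> R[i]) (a : R[i]) :
  f @ F --> a -> (fun x => complex.Re (f x)) @ F --> complex.Re a.
Proof.
move=> /complex_cvgP H; apply/cvgrPdist_le => e e0.
apply: filterS (H _ e0) => x /=; rewrite -raddfB => Hx; rewrite -lecR.
exact: le_trans (normc_ge_Re _) Hx.
Qed.

Lemma cvg_real_complex (R : realType) (F : set_system R) (FF : Filter F)
    (f : R -> R) (a : R) :
  f @ F --> a -> (fun x => (f x)%:C) @ F --> a%:C.
Proof.
move=> /cvgrPdist_le H; apply/complex_cvgP => e e0.
apply: filterS (H _ e0) => x /=.
by rewrite -rmorphB normc_def /= expr0n addr0 sqrtr_sqr lecR.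
Qed.

Lemma cvg_conjC (R : realType) (F : set_system R) (FF : Filter F)
    (f : R -> R[i]) (a : R[i]) :
  f @ F --> a -> (fun x => (f x)^*%R) @ F --> a^*%R.
Proof.
move=> /complex_cvgP H; apply/complex_cvgP => e e0.
by apply: filterS (H _ e0) => x /=; rewrite -rmorphB norm_conjC.
Qed.

Lemma complex_cvg_sum (R : realType) (F : set_system R) (FF : Filter F)
    (I : Type) (r : seq I) (P : pred I) (f : I -> R -> R[i]) (a : I -> R[i]) :
  (forall i, f i @ F --> a i) ->
  (fun x => \sum_(i <- r | P i) f i x) @ F --> \sum_(i <- r | P i) a i.
Proof.
move=> fa; apply: (@cvg_big R[i]^o) => // z.
exact: (@add_continuous R[i]^o z).
Qed.

Lemma complex_cvg_prod (R : realType) (F : set_system R) (FF : Filter F)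
    (I : Type) (r : seq I) (P : pred I) (f : I -> R -> R[i]) (a : I -> R[i]) :
  (forall i, f i @ F --> a i) ->
  (fun x => \prod_(i <- r | P i) f i x) @ F --> \prod_(i <- r | P i) a i.
Proof.
move=> fa; apply: (@cvg_big R[i]^o) => // z.
exact: (@mul_continuous R[i] z).
Qed.

(** Entrywise convergence reduces the limit rules for products, traces, determinants and inverses to
    those for complex scalars. Only its deduction from matrix convergence is required, since the
    final limits are scalar. *)
Definition mx_cvg (R : realType) (m n : nat) (F : set_system R)
    (f : R -> 'M[R[i]]_(m, n)) (a : 'M[R[i]]_(m, n)) : Prop :=
  forall i j, (fun x => f x i j) @ F --> a i j.

Lemma cvg_mx_cvg (R : realType) (m n : nat) (F : set_system R)
    (FF : Filter F) (f : R -> 'M[R[i]]_(m, n)) (a : 'M[R[i]]_(m, n)) :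
  f @ F --> a -> mx_cvg F f a.
Proof.
move=> fa i j U HU; apply: (fa [set M : 'M[R[i]]_(m, n) | U (M i j)]).
exists (fun i' j' => if (i' == i) && (j' == j) then U else setT).
  by move=> i' j'; case: ifPn => [/andP[/eqP-> /eqP->] //|_]; exact: filterT.
by move=> M /(_ i j) /=; rewrite !eqxx.
Qed.

Lemma mx_cvg_cst (R : realType) (m n : nat) (F : set_system R)
    (FF : Filter F) (a : 'M[R[i]]_(m, n)) : mx_cvg F (fun=> a) a.
Proof. by move=> i j; exact: cvg_cst. Qed.

Lemma mx_cvgD (R : realType) (m n : nat) (F : set_system R)
    (FF : Filter F) (f g : R -> 'M[R[i]]_(m, n)) (a b : 'M[R[i]]_(m, n)) :
  mx_cvg F f a -> mx_cvg F g b ->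
  mx_cvg F (fun x => f x + g x) (a + b).
Proof.
move=> fa gb i j; rewrite mxE; under eq_cvg do rewrite mxE.
by apply: (@cvgD R[i] R[i]^o); [exact: fa|exact: gb].
Qed.

Lemma mx_cvgB (R : realType) (m n : nat) (F : set_system R)
    (FF : Filter F) (f g : R -> 'M[R[i]]_(m, n)) (a b : 'M[R[i]]_(m, n)) :
  mx_cvg F f a -> mx_cvg F g b ->
  mx_cvg F (fun x => f x - g x) (a - b).
Proof.
move=> fa gb i j; rewrite !mxE; under eq_cvg do rewrite !mxE.
by apply: (@cvgB R[i] R[i]^o); [exact: fa|exact: gb].
Qed.

Lemma mx_cvgZ (R : realType) (m n : nat) (F : set_system R)
    (FF : Filter F) (c : R -> R[i]) (f : R -> 'M[R[i]]_(m, n)) (l : R[i])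
    (a : 'M[R[i]]_(m, n)) :
  c @ F --> l -> mx_cvg F f a ->
  mx_cvg F (fun x => c x *: f x) (l *: a).
Proof.
move=> cl fa i j; rewrite mxE; under eq_cvg do rewrite mxE.
by apply: cvgM; [exact: cl|exact: fa].
Qed.

Lemma mx_cvgM (R : realType) (m n p : nat) (F : set_system R)
    (FF : Filter F) (f : R -> 'M[R[i]]_(m, n)) (g : R -> 'M[R[i]]_(n, p))
    (a : 'M[R[i]]_(m, n)) (b : 'M[R[i]]_(n, p)) :
  mx_cvg F f a -> mx_cvg F g b ->
  mx_cvg F (fun x => f x *m g x) (a *m b).
Proof.
move=> fa gb i j; rewrite mxE; under eq_cvg do rewrite mxE.
by apply: complex_cvg_sum => k; apply: cvgM; [exact: fa|exact: gb].
Qed.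

Lemma mx_cvg_trC (R : realType) (m n : nat) (F : set_system R)
    (FF : Filter F) (f : R -> 'M[R[i]]_(m, n)) (a : 'M[R[i]]_(m, n)) :
  mx_cvg F f a -> mx_cvg F (fun x => (f x) ^t*) (a ^t*).
Proof.
move=> fa i j; rewrite !mxE; under eq_cvg do rewrite !mxE.
by apply: cvg_conjC; exact: fa.
Qed.

Lemma mx_cvg_trace (R : realType) (n : nat) (F : set_system R)
    (FF : Filter F) (f : R -> 'M[R[i]]_n) (a : 'M[R[i]]_n) :
  mx_cvg F f a -> (fun x => \tr (f x)) @ F --> \tr a.
Proof. by move=> fa; apply: complex_cvg_sum => i; exact: fa. Qed.

Lemma mx_cvg_det (R : realType) (n : nat) (F : set_system R)
    (FF : Filter F) (f : R -> 'M[R[i]]_n) (a : 'M[R[i]]_n) :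
  mx_cvg F f a -> (fun x => \det (f x)) @ F --> \det a.
Proof.
move=> fa; apply: complex_cvg_sum => s; apply: cvgM; first exact: cvg_cst.
by apply: complex_cvg_prod => i; exact: fa.
Qed.

(** By the adjugate formula the entries of the inverse are cofactors divided by the determinant,
    whose limit is nonzero. *)
Lemma mx_cvg_invmx (R : realType) (n : nat) (F : set_system R)
    (FF : Filter F) (f : R -> 'M[R[i]]_n) (a : 'M[R[i]]_n) :
  mx_cvg F f a -> (\forall x \near F, f x \in unitmx) -> a \in unitmx ->
  mx_cvg F (fun x => invmx (f x)) (invmx a).
Proof.
move=> fa fu au i j.
have H : mx_cvg F (fun x => (\det (f x))^-1 *: \adj (f x)) (invmx a).
  rewrite /invmx au; apply: mx_cvgZ.
    apply: cvgV; first by rewrite -unitfE.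
    exact: mx_cvg_det.
  move=> k l; have -> : (fun x => (\adj (f x)) k l) = (fun x => cofactor (f x) l k).
    by apply/funext => x; rewrite [LHS]mxE.
  rewrite [X in _ --> X]mxE.
  apply: (@cvgM R[i] R F FF (fun=> (-1) ^+ (l + k))); first exact: cvg_cst.
  apply: mx_cvg_det => u v; rewrite !mxE; under eq_cvg do rewrite !mxE.
  exact: fa.
apply: cvg_trans (H i j); apply: near_eq_cvg.
by apply: filterS fu => x xu; rewrite /invmx xu.
Qed.

(** * Continuity of differentiable matrix functions and of the scalar coefficients *)

Lemma mx_deriv_cvg_punctured (R : realType) (t0 t : R) (n : nat)
    (F : R -> 'M[R[i]]_n) :
  t0 <= t -> has_mx_deriv t0 F ->
  mx_cvg (punctured_nbhs t0 t) F (F t).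
Proof.
move=> tt dF; have PF := punctured_nbhs_filter tt.
(* Away from [t] this expression equals [F x], and its second summand tends to [0] times the
   derivative. *)
have H : mx_cvg (punctured_nbhs t0 t)
    (fun x => F t + (x - t)%:C *: mx_quotient F t x) (F t).
  rewrite -[X in mx_cvg _ _ X]addr0 -(scale0r (mx_deriv t0 F t)).
  apply: mx_cvgD; first exact: mx_cvg_cst.
  apply: mx_cvgZ; last exact: cvg_mx_cvg (dF t tt).
  apply: (@cvg_real_complex _ _ _ (fun x => x - t) 0); rewrite -(subrr t).
  apply: cvgB; last exact: cvg_cst.
  apply: (cvg_trans (@cvg_within _ _ _ _)); exact: nbhs_dnbhs.
move=> i j; apply: cvg_trans (H i j); apply: near_eq_cvg.
have : \forall x \near t^', x != t by exact: nbhs_dnbhs_neq.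
move=> /(@cvg_within _ _ _ [set` `[t0, +oo[]); apply: filterS => x xt.
by rewrite /mx_quotient scalerA -rmorphM divff ?subr_eq0// scale1r addrC subrK.
Qed.

Lemma mx_deriv_cvg_within (R : realType) (t0 t : R) (n : nat)
    (F : R -> 'M[R[i]]_n) :
  t0 <= t -> has_mx_deriv t0 F ->
  mx_cvg (within [set` `[t0, +oo[] (nbhs t)) F (F t).
Proof.
move=> tt dF i j; apply/complex_cvgP => e e0.
have PF := punctured_nbhs_filter tt.
have /(_ i j)/complex_cvgP/(_ e e0) := mx_deriv_cvg_punctured tt dF.
rewrite /punctured_nbhs !near_withinE => H.
apply: (@filterS _ (nbhs t) _ _ _ _ H) => x Hx xt0.
have [->|xt] := eqVneq x t; first by rewrite subrr normr0 (lecR 0) ltW.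
exact: Hx.
Qed.

Lemma within_continuous_mx_cvg (R : realType) (t0 t : R) (n : nat)
    (F : R -> 'M[R[i]]_n) :
  {within `[t0, +oo[, continuous F} -> t0 <= t ->
  mx_cvg (within [set` `[t0, +oo[] (nbhs t)) F (F t).
Proof. by move=> /within_halfline_continuousP cF tt; apply: cvg_mx_cvg; exact: cF. Qed.

(** Both differences of least eigenvalues are dominated by the sum [s] of the moduli of the entries
    of [B t - B x], which tends to [0]. *)
Lemma least_eigenvalue_continuous (R : realType) (t0 : R) (n : nat)
    (B : R -> 'M[R[i]]_n) : (0 < n)%N ->
  {within `[t0, +oo[, continuous B} -> (forall t, t0 <= t -> B t = (B t) ^t*) ->
  {within `[t0, +oo[, continuous (fun t => least_eigenvalue (B t))}.
Proof.
move=> n0 cB hB; apply/within_halfline_continuousP => t tt.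
pose s x := \sum_i \sum_j `|(B t - B x) i j|.
have s0 : s x @[x --> within [set` `[t0, +oo[] (nbhs t)] --> (0 : R[i]).
  have -> : 0 = \sum_(i < n) \sum_(j < n) `|(B t - B t) i j| :> R[i].
    by rewrite !big1// => i _; rewrite big1// => j _; rewrite subrr mxE normr0.
  apply: complex_cvg_sum => i; apply: complex_cvg_sum => j.
  apply: (@cvg_norm R[i] R[i]^o).
  apply: (@mx_cvgB _ _ _ _ _ (fun=> B t) B); first exact: mx_cvg_cst.
  exact: within_continuous_mx_cvg.
have sE x : s x = \sum_i \sum_j `|(B x - B t) i j|.
  by apply: eq_bigr => i _; apply: eq_bigr => j _; rewrite -opprB mxE normrN.
apply/cvgrPdist_le => e e0.
have /complex_cvgP/(_ e e0) := s0; rewrite !near_withinE; apply: filterS => x Hx xt0.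
have {}Hx := Hx xt0; have {xt0}t0x : t0 <= x by move: xt0; rewrite /= in_itv /= andbT.
have {Hx} sx : s x <= e%:C.
  apply: le_trans Hx; rewrite sub0r normrN real_ler_norm// ger0_real//.
  by apply: sumr_ge0 => i _; apply: sumr_ge0.
rewrite ler_norml; apply/andP; split; last first.
  rewrite -lecR; apply: le_trans sx.
  by apply: least_eigenvalue_sub_le; [|exact: hB|exact: hB].
rewrite lerNl opprB -lecR; apply: le_trans sx; rewrite sE.
by apply: least_eigenvalue_sub_le; [|exact: hB|exact: hB].
Qed.

Lemma trace_D_S_continuous (R : realType) (t0 : R) (n : nat)
    (A B C S : R -> 'M[R[i]]_n) :
  {within `[t0, +oo[, continuous A} ->
  {within `[t0, +oo[, continuous B} ->
  {within `[t0, +oo[, continuous C} ->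
  continuously_differentiable t0 S ->
  {within `[t0, +oo[, continuous (fun t => complex.Re (\tr (D_S t0 A B C S t)))}.
Proof.
move=> cA cB cC [dS cdS]; apply/within_halfline_continuousP => t tt.
apply: cvg_Re; apply: mx_cvg_trace.
have lA := within_continuous_mx_cvg cA tt.
have lB := within_continuous_mx_cvg cB tt.
have lC := within_continuous_mx_cvg cC tt.
have lS' := within_continuous_mx_cvg cdS tt.
have lS := mx_deriv_cvg_within tt dS.
have FF : Filter (within [set` `[t0, +oo[] (nbhs t)) by typeclasses eauto.
have lAS := mx_cvgM FF (mx_cvg_trC FF lA) lS.
have lSBS := mx_cvgM FF (mx_cvgM FF lS lB) lS.
have lSA := mx_cvgM FF lS lA.
exact: (mx_cvgB FF (mx_cvgD FF (mx_cvgD FF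
  (mx_cvgD FF lS' lSBS) lAS) lSA) lC).
Qed.

(** * The matrix Riccati equation *)

(** Multiplying by [Phi ^t*] on the left and by [Phi] on the right, both invertible, turns the claim
    into the prepared condition. *)
Lemma hermitian_riccati (C : numClosedFieldType) (n : nat) (Phi Psi : 'M[C]_n) :
  Phi \in unitmx -> Phi ^t* *m Psi = Psi ^t* *m Phi ->
  Psi *m invmx Phi = (Psi *m invmx Phi) ^t*.
Proof.
move=> Pu prep; have Pu' : Phi ^t* \in unitmx by rewrite map_unitmx unitmx_tr.
apply: (can_inj (mulKmx Pu')); apply: (can_inj (mulmxK Pu)).
rewrite !mulmxA mulmxKV// prep.
have {1}<- : (Psi *m invmx Phi) *m Phi = Psi by rewrite mulmxKV.
by rewrite trmx_mul map_mxM.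
Qed.

(** The equation for [S] makes [m * \tr Z] the trace of [Z] times [B *m S + S *m B + A + A'];
    cyclicity of the trace then matches the remaining terms. In the application [m] is [2 * mu t]
    and [A'] is the adjoint of [A]. *)
Lemma riccati_difference_trace (K : comNzRingType) (n : nat)
    (A A' B C S S' Y : 'M[K]_n) (m : K) :
  B *m S + S *m B = m%:M - A - A' ->
  let D := S' + S *m B *m S + A' *m S + S *m A - C in
  let Z := Y - S in
  \tr (C - A' *m Y - Y *m A - Y *m B *m Y - S') =
  - \tr (Z *m B *m Z) - m * \tr Z - \tr D.
Proof.
move=> BS D Z.
have trB (U V : 'M[K]_n) : \tr (U - V) = \tr U - \tr V by exact: raddfB.
have trD (U V : 'M[K]_n) : \tr (U + V) = \tr U + \tr V by exact: raddfD.
have mZ : m * \tr Z = \tr (Z *m (B *m S)) + \tr (Z *m (S *m B)) + \tr (Z *m A) +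
    \tr (Z *m A').
  rewrite -!trD -!mulmxDr BS; have -> : m%:M - A - A' + A + A' = m%:M.
    by rewrite addrAC subrK subrK.
  by rewrite mul_mx_scalar mxtraceZ.
move: mZ; rewrite /D /Z !(mulmxBl, mulmxBr) !(trB, trD) !mulmxA.
rewrite (mxtrace_mulC Y A') (mxtrace_mulC S A').
rewrite -(mulmxA Y S B) (mxtrace_mulC Y (S *m B)).
rewrite -(mulmxA S S B) (mxtrace_mulC S (S *m B)).
by move=> ->; ring.
Qed.

Lemma Re_realM (R : realType) (k : R) (z : R[i]) :
  complex.Re (k%:C * z) = k * complex.Re z.
Proof. by case: z => a b /=; rewrite mul0r subr0. Qed.

(** The quotient rule for [Q *m invmx P] at the level of difference quotients, exact before any
    limit is taken. *)
Lemma mulmx_invmx_sub (K : comUnitRingType) (n : nat) (c : K) (P P1 Q Q1 S S1 : 'M[K]_n) :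
  P \in unitmx -> P1 \in unitmx ->
  c *: (Q1 *m invmx P1 - S1 - (Q *m invmx P - S)) =
  (c *: (Q1 - Q)) *m invmx P1 -
    Q *m invmx P *m (c *: (P1 - P)) *m invmx P1 - c *: (S1 - S).
Proof.
move=> Pu P1u; rewrite -scalemxAr -!scalemxAl -!scalerBr; congr (_ *: _).
rewrite mulmxBl mulmxBr mulmxBl (mulmxK P1u) (mulmxKV Pu).
move: (Q1 *m _) (Q *m invmx P) (Q *m invmx P1) => X1 X W.
by rewrite !opprB !addrA subrK addrAC [X1 - S1 - X]addrAC addrAC.
Qed.

Lemma mulmx_invmx_riccati (K : comUnitRingType) (n : nat) (A A' B C P Q : 'M[K]_n) :
  P \in unitmx -> let Y := Q *m invmx P in
  (C *m P - A' *m Q) *m invmx P - Y *m (A *m P + B *m Q) *m invmx P =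
  C - A' *m Y - Y *m A - Y *m B *m Y.
Proof.
move=> Pu Y; rewrite mulmxBl mulmxDr mulmxDl !mulmxA !(mulmxK Pu).
by rewrite opprD addrA -!(mulmxA _ Q).
Qed.

(** The limit of [mulmx_invmx_sub] gives the derivative of [Y], and the hamiltonian equations turn
    it into the Riccati right-hand side. Strictness of [t0 < t] makes the relative derivatives
    two-sided. *)
Lemma riccati_derivative (R : realType) (t0 t : R) (n : nat)
    (A B C S Phi Psi : R -> 'M[R[i]]_n) : t0 < t ->
  has_mx_deriv t0 S -> hamiltonian_solution t0 A B C Phi Psi ->
  Phi t \in unitmx -> (\forall x \near t^', Phi x \in unitmx) ->
  let Y x := Psi x *m invmx (Phi x) in
  is_derive t (1 : R) (fun x => complex.Re (\tr (Y x - S x)))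
    (complex.Re (\tr (C t - (A t) ^t* *m Y t - Y t *m A t - Y t *m B t *m Y t -
      mx_deriv t0 S t))).
Proof.
move=> t0t dS [[dPhi _] [dPsi _] sol] ut ux Y; have tt := ltW t0t.
apply/dnbhs_quotientP; rewrite -(punctured_nbhs_interior t0t) in ux *.
have PF := punctured_nbhs_filter tt.
have FF : Filter (punctured_nbhs t0 t) by exact: PF.
have lPhi := cvg_mx_cvg FF (dPhi t tt).
have lPsi := cvg_mx_cvg FF (dPsi t tt).
have lS := cvg_mx_cvg FF (dS t tt).
have linv := mx_cvg_invmx FF (mx_deriv_cvg_punctured tt dPhi) ux ut.
have lY1 := mx_cvgM FF lPsi linv.
have lY2 := mx_cvgM FF (mx_cvgM FF
  (@mx_cvg_cst _ _ _ _ FF (Y t)) lPhi) linv.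
have := cvg_Re FF (mx_cvg_trace FF
  (mx_cvgB FF (mx_cvgB FF lY1 lY2) lS)).
have -> : mx_deriv t0 Psi t *m invmx (Phi t) -
    Y t *m mx_deriv t0 Phi t *m invmx (Phi t) =
    C t - (A t) ^t* *m Y t - Y t *m A t - Y t *m B t *m Y t.
  by have [-> ->] := sol t tt; exact: mulmx_invmx_riccati.
apply: cvg_trans; apply: near_eq_cvg; apply: filterS ux => x ux.
rewrite /quotient -raddfB -raddfB /= -Re_realM -mxtraceZ; congr (complex.Re (\tr _)).
by rewrite (@mulmx_invmx_sub _ _ _ (Phi t) (Phi x)).
Qed.

Theorem corollary2p2 (R : realType) (n : nat) (n_gt0 : (0 < n)%N) (t0 : R)
    (A B C : R -> 'M[R[i]]_n) (mu : R -> R)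
    (A_cont : {within `[t0, +oo[, continuous A})
    (B_cont : {within `[t0, +oo[, continuous B})
    (C_cont : {within `[t0, +oo[, continuous C})
    (B_herm : forall t, t0 <= t -> B t = (B t) ^t*)
    (C_herm : forall t, t0 <= t -> C t = (C t) ^t*)
    (mu_cont : {within `[t0, +oo[, continuous mu})
    (B_ge0 : forall t, t0 <= t -> nonneg_definite (B t))
    (S : R -> 'M[R[i]]_n)
    (S_C1 : continuously_differentiable t0 S)
    (S_herm : forall t, t0 <= t -> S t = (S t) ^t*)
    (S_eq : forall t, t0 <= t ->
      B t *m S t + S t *m B t = (2 * mu t)%:C%:M - A t - (A t) ^t*)
    (scalar_osc : scalar_oscillatory t0
      mu (fun t => least_eigenvalue (B t) / n%:R)
      (fun t => - complex.Re (\tr (D_S t0 A B C S t))) (fun t => - mu t)) :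
  hamiltonian_oscillatory t0 A B C.
Proof.
move=> Phi Psi sol prep T; apply: contrapT => noz.
(* [Phi] is invertible from [T0] on. The shift to [T1] leaves room for a two-sided neighbourhood of
   every [t >= T1] on which it stays invertible. *)
pose T0 := Num.max t0 T; pose T1 := T0 + 1.
have T01 : T0 < T1 by rewrite ltrDl.
have t0T0 : t0 <= T0 by rewrite le_max lexx.
have t0T1 : t0 <= T1 := le_trans t0T0 (ltW T01).
have Phi_unit t : T0 <= t -> Phi t \in unitmx.
  move=> T0t; rewrite unitmxE unitfE; apply/eqP => d0; apply: noz; exists t.
  by split=> //; apply: le_trans T0t; rewrite ?t0T0// le_max lexx orbT.
pose Y t := Psi t *m invmx (Phi t).
pose y t := complex.Re (\tr (Y t - S t)).
pose y' t := complex.Re (\tr (C t - (A t) ^t* *m Y t - Y t *m A t -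
  Y t *m B t *m Y t - mx_deriv t0 S t)).
have p_cont : {within `[t0, +oo[, continuous (fun t => least_eigenvalue (B t) / n%:R)}.
  move=> t; apply: cvgM; last exact: cvg_cst.
  exact: least_eigenvalue_continuous.
have p_ge0 t : t0 <= t -> 0 <= least_eigenvalue (B t) / n%:R.
  by move=> tt; rewrite divr_ge0// least_eigenvalue_ge0//; exact: B_ge0.
have q_cont := trace_D_S_continuous A_cont B_cont C_cont S_C1.
have dy t : T1 <= t -> is_derive t (1 : R) y (y' t).
  move=> T1t; have T0t := lt_le_trans T01 T1t.
  apply: riccati_derivative => //.
  - exact: le_lt_trans T0t.
  - by case: S_C1.
  - exact/Phi_unit/ltW.
  - apply: nbhs_dnbhs; have : \forall x \near t, T0 < x by exact: lt_nbhsr.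
    by apply: filterS => x /ltW; exact: Phi_unit.
have aux (u v l s m : R) : l * s ^+ 2 <= u ->
    - u - 2 * m * s - v + l * s ^+ 2 + 2 * m * s + v <= 0 by lra.
have ReB (a b : R[i]) : complex.Re (a - b) = complex.Re a - complex.Re b.
  exact: raddfB.
have ReN (a : R[i]) : complex.Re (- a) = - complex.Re a by exact: raddfN.
have ineq t : T1 <= t -> y' t + least_eigenvalue (B t) / n%:R * y t ^+ 2 +
    2 * mu t * y t + complex.Re (\tr (D_S t0 A B C S t)) <= 0.
  move=> T1t; have tt := le_trans t0T1 T1t.
  have ut := Phi_unit t (le_trans (ltW T01) T1t).
  have Zh : Y t - S t = (Y t - S t) ^t*.
    rewrite linearB /= map_mxB -S_herm// -hermitian_riccati//; exact: prep.
  have := mxtrace_quadratic_le n_gt0 (B_ge0 t tt) Zh.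
  rewrite /y' (riccati_difference_trace _ (mx_deriv t0 S t) _ (S_eq t tt)).
  rewrite !ReB ReN Re_realM -/(D_S t0 A B C S t) -/(y t).
  exact: aux.
have [phi [psi [dphi phi0]]] := riccati_inequality_nonoscillation
  p_cont q_cont mu_cont t0T1 (fun t Tt => p_ge0 t (le_trans t0T1 Tt)) dy ineq.
have [hphi Ephi] := is_derive_deriv_at (fun t tt => (dphi t tt).1).
have [hpsi Epsi] := is_derive_deriv_at (fun t tt => (dphi t tt).2).
(* Oscillation of the scalar system yields a zero of [phi] beyond [T1], where [phi] does not
   vanish. *)
have [|t [_ /phi0 + phit]] := scalar_osc phi psi _ T1; last by rewrite phit eqxx.
by split=> // t tt; rewrite Ephi// Epsi.
Qed.
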